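(* Consider a fair division instance with additive binary valuations on a multigraph, and let $X$ be an input orientation. Then there always exists a sequence of valid transfers from $X$ (all of whose intermediate allocations are orientations) that ends in an $\mathsf{EF1}$ allocation that is an orientation, and such a sequence can be computed in polynomial time.
   Context: Additive binary valuations on a multigraph: the agents $[n]$ are the vertices and the items $\mathcal{G}$ are the edges of a finite multigraph (parallel edges allowed); an item $g$ that is an edge between agents $i\ne j$ satisfies $v_i(g)=v_j(g)=1$ and $v_k(g)=0$ for all $k\ne i,j$; and $v_i(S)=\sum_{g\in S}v_i(g)$. An allocation $X=(X_1,\ldots,X_n)$ is a partition of $\mathcal{G}$ into $n$ (possibly empty) bundles. An allocation is an orientation if every item is allocated to an agent who has positive marginal value for it (i.e. every edge is given to one of its endpoints). The amount of $\mathsf{EF1}$-envy of $i$ towards $j$ in $X$ is $\varepsilon_{i\to j}(X)=\min_{g\in X_j}\{v_i(X_j\setminus\{g\})-v_i(X_i)\}$, with the convention $\varepsilon_{i\to j}(X)=-v_i(X_i)$ if $X_j=\emptyset$. $X$ is $\mathsf{EF1}$ if $\varepsilon_{i\to j}(X)\le 0$ for all $i,j\in[n]$. A transfer moves a single item from one agent's bundle to another agent's bundle, turning $X$ into $Y$. It is valid if for all $i,j\in[n]$, either $\varepsilon_{i\to j}(Y)\le 0$ or $\varepsilon_{i\to j}(Y)\le\varepsilon_{i\to j}(X)$; moreover, if $X$ is an orientation, $Y$ is required to be an orientation too. In a sequence of valid transfers, each transfer is valid with respect to the current allocation. *)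

(* Defs.v *)
From mathcomp Require Import all_boot all_order all_algebra.

Set Implicit Arguments.
Unset Strict Implicit.
Unset Printing Implicit Defensive.

Import Order.TTheory GRing.Theory Num.Theory.

(* Agents are 'I_n, items form a finType G, and v i g is the value of the     *)
(* single item g to agent i.  An allocation maps each item to its owner, so   *)
(* that the bundles automatically partition the items and may be empty.       *)

Definition bundle_val n (G : finType) (v : 'I_n -> G -> nat) (i : 'I_n)
    (S : {set G}) : nat :=
  \sum_(g in S) v i g.

(* The valuations of the multigraph whose edge g joins the two agents of the  *)
(* set [ends g] (assumed of cardinal 2); [ends] need not be injective, which  *)
(* is how parallel edges arise.                                               *)
Definition edge_val n (G : finType) (ends : G -> {set 'I_n}) (i : 'I_n) (g : G)
    : nat :=
  if i \in ends g then 1 else 0.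

Definition bundle n (G : finType) (X : {ffun G -> 'I_n}) (i : 'I_n) : {set G} :=
  [set g | X g == i].

(* Valuations are additive, so the marginal value of g to its owner does not  *)
(* depend on the rest of the bundle.                                          *)
Definition orientation n (G : finType) (v : 'I_n -> G -> nat)
    (X : {ffun G -> 'I_n}) : bool :=
  [forall g, 0 < v (X g) g].

Definition ef1_envy n (G : finType) (v : 'I_n -> G -> nat)
    (X : {ffun G -> 'I_n}) (i j : 'I_n) : int :=
  let own : int := Posz (bundle_val v i (bundle X i)) in
  let gap (g : G) : int :=
    (Posz (bundle_val v i (bundle X j :\ g)) - own)%R in
  if [pick g in bundle X j] is Some g0
  then gap [arg min_(g < g0 in bundle X j) gap g]%O
  else (- own)%R.

Definition ef1 n (G : finType) (v : 'I_n -> G -> nat) (X : {ffun G -> 'I_n})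
    : bool :=
  [forall i, forall j, (ef1_envy v X i j <= 0)%R].

(* A transfer is given by the item that moves and the agent who receives it.  *)
Definition transfer n (G : finType) (X : {ffun G -> 'I_n}) (t : G * 'I_n)
    : {ffun G -> 'I_n} :=
  [ffun g => if g == t.1 then t.2 else X g].

Definition valid_transfer n (G : finType) (v : 'I_n -> G -> nat)
    (X : {ffun G -> 'I_n}) (t : G * 'I_n) : bool :=
  let Y := transfer X t in
  [&& t.2 != X t.1,
      [forall i, forall j, (ef1_envy v Y i j <= 0)%R
                           || (ef1_envy v Y i j <= ef1_envy v X i j)%R]
    & orientation v X ==> orientation v Y].

Fixpoint valid_transfers n (G : finType) (v : 'I_n -> G -> nat)
    (X : {ffun G -> 'I_n}) (ts : seq (G * 'I_n)) : bool :=
  if ts is t :: ts' then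
    valid_transfer v X t && valid_transfers v (transfer X t) ts'
  else true.

Definition leads_to_ef1_orientation n (G : finType) (v : 'I_n -> G -> nat)
    (X : {ffun G -> 'I_n}) (ts : seq (G * 'I_n)) : Prop :=
  let Y := foldl (@transfer n G) X ts in
  [/\ valid_transfers v X ts,
      all (orientation v) (scanl (@transfer n G) X ts),
      orientation v Y
    & ef1 v Y].

(* Polynomial time is measured on a random access machine with addition and   *)
(* truncated subtraction, indirect addressing and structured control, every   *)
(* operation costing one step.  There is no multiplication: apart from the     *)
(* constants of the program, a step increases the bit length of the largest   *)
(* number by at most one, so polynomial time here is polynomial time on a     *)
(* Turing machine.                                                            *)

Inductive prog : Type :=
| PConst of nat & nat           (* PConst x k   : r_x := k           *)
| PAdd of nat & nat & nat       (* PAdd x y z   : r_x := r_y + r_z   *)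
| PSub of nat & nat & nat       (* PSub x y z   : r_x := r_y - r_z   *)
| PLoad of nat & nat            (* PLoad x y    : r_x := mem[r_y]    *)
| PStore of nat & nat           (* PStore x y   : mem[r_x] := r_y    *)
| PSeq of prog & prog
| PIf of nat & prog & prog      (* the test is r_x <> 0              *)
| PWhile of nat & prog.         (* the test is r_x <> 0              *)

Record ram_state := RamState { reg : nat -> nat; mem : nat -> nat }.

Definition set_reg (s : ram_state) (x k : nat) : ram_state :=
  RamState (fun y => if y == x then k else reg s y) (mem s).

Definition set_mem (s : ram_state) (a k : nat) : ram_state :=
  RamState (reg s) (fun b => if b == a then k else mem s b).

(* [run p s t s'] : started in s, the program p halts in s' after t steps.    *)
Inductive run : prog -> ram_state -> nat -> ram_state -> Prop :=
| RunConst x k s : run (PConst x k) s 1 (set_reg s x k)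
| RunAdd x y z s : run (PAdd x y z) s 1 (set_reg s x (reg s y + reg s z))
| RunSub x y z s : run (PSub x y z) s 1 (set_reg s x (reg s y - reg s z))
| RunLoad x y s : run (PLoad x y) s 1 (set_reg s x (mem s (reg s y)))
| RunStore x y s : run (PStore x y) s 1 (set_mem s (reg s x) (reg s y))
| RunSeq p q s t s' t' s'' :
    run p s t s' -> run q s' t' s'' -> run (PSeq p q) s (t + t') s''
| RunIfTrue x p q s t s' :
    reg s x != 0 -> run p s t s' -> run (PIf x p q) s t.+1 s'
| RunIfFalse x p q s t s' :
    reg s x = 0 -> run q s t s' -> run (PIf x p q) s t.+1 s'
| RunWhileTrue x p s t s' t' s'' :
    reg s x != 0 -> run p s t s' -> run (PWhile x p) s' t' s'' ->
    run (PWhile x p) s (t + t').+1 s''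
| RunWhileFalse x p s : reg s x = 0 -> run (PWhile x p) s 1 s.

Definition init_state (w : seq nat) : ram_state :=
  RamState (fun _ => 0) (fun a => nth 0 w a).

Definition outputs_within (p : prog) (w : seq nat) (bound : nat) (w' : seq nat)
    : Prop :=
  exists (t : nat) (s : ram_state),
    [/\ run p (init_state w) t s, t <= bound
      & forall a, a < size w' -> mem s a = nth 0 w' a].

(* Items are named by their rank in [enum G].  The input is n, the number of  *)
(* items and then, for each item, its owner followed by its two endpoints.    *)
Definition encode_input n (G : finType) (ends : G -> {set 'I_n})
    (X : {ffun G -> 'I_n}) : seq nat :=
  [:: n, #|G| & flatten [seq val (X g) :: [seq val i | i <- enum (ends g)]
                            | g <- enum G]].

(* The leading length makes the code prefix-free, so that a memory contains   *)
(* the code of at most one sequence of transfers.                             *)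
Definition encode_output n (G : finType) (ts : seq (G * 'I_n)) : seq nat :=
  size ts :: flatten [seq [:: val (enum_rank t.1); val t.2] | t <- ts].

(* Main.v *)
Require Import Defs.
From mathcomp Require Import all_boot all_order all_algebra zify.

(* Let [held k c] be the number of items of k's bundle that c values, and     *)
(* d c = [held c c] the size of c's bundle, so that c EF1-envies k iff        *)
(* [held k c] >= d c + 2; call c restless if [held k c] > d c for some k.     *)
(* Start from an EF1-envious agent and move repeatedly from c to the agent k  *)
(* maximising [held k c], as long as that agent is itself restless.  Bundle   *)
(* sizes strictly increase, so this stops at some c whose favourite k is not  *)
(* restless, and moving an item between c and k from k to c is valid.  The    *)
(* sum of the d^2 does not increase, and it decreases unless d k = d c + 1.   *)
(* In that case c is no longer restless, the starting agent is still          *)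
(* EF1-envious, and the next climb follows the same chain but stops strictly  *)
(* before c, hence at a smaller bundle.  So the sum of squares, refined by    *)
(* the size of the bundle where the climb stops, is a decreasing potential of *)
(* polynomial size.                                                           *)
(*   On the machine everything is a bounded loop whose bound is one of n,     *)
(* |G| and |G| + 2, which makes the running time visibly polynomial: a step   *)
(* that finds no EF1-envious agent does nothing, so (|G| + 2)^3 steps can be  *)
(* run blindly.                                                               *)

Set Implicit Arguments.
Unset Strict Implicit.
Unset Printing Implicit Defensive.

Import Order.TTheory GRing.Theory Num.Theory.
(* [mem] is the memory of a machine state from here on, not [ssrbool.mem].    *)
Import Defs.

(** * Envy and potential *)

(** An edge is worth 1 to its endpoints and 0 to everyone else, so all envy is read off the counts
    [held X k c] ([ef1_envy_le0]). Giving an edge of j to its other endpoint i is harmless when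
    nobody holds more of j's items than j and i holds strictly fewer ([valid_transfer_safe]). The
    end of a climb supplies such a pair ([excess_favourite_summit]). Each transfer lowers the
    potential ([potential_decrease]). The delicate case is an excess of exactly 1 at the end of the
    climb, where the next climb must end at a smaller bundle ([summit_decrease]). By [potential_lt]
    the number of transfers is at most cubic in |G|. The algorithm is a program of bounded loops.
    Its running time follows from its syntax alone ([run_compile]), its correctness from loop
    invariants ([for_ind]). Both halves of the theorem come from [l_mainP]. *)

Section Multigraph.

Variables (n : nat) (G : finType) (ends : G -> {set 'I_n}).
Hypothesis ends2 : forall g : G, #|ends g| = 2.

Implicit Types (X Y : {ffun G -> 'I_n}) (a b c i j k : 'I_n) (g : G).

Notation v := (edge_val ends).

Definition held X k c : nat := #|[set g | (X g == k) && (c \in ends g)]|.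

Lemma heldE X k c : bundle_val v c (bundle X k) = held X k c.
Proof.
rewrite /bundle_val /held -sum1_card.
rewrite [in RHS](eq_bigl (fun g => (g \in bundle X k) && (c \in ends g))).
  by rewrite big_mkcondr.
by move=> g; rewrite !inE.
Qed.

Lemma orientP X : reflect (forall g, X g \in ends g) (orientation v X).
Proof.
apply: (iffP forallP) => h g; have := h g; rewrite /edge_val; first by case: ifP.
by move=> ->.
Qed.

Lemma held_le X k c : orientation v X -> held X k c <= held X k k.
Proof.
move/orientP => oX; apply/subset_leq_card/subsetP => g; rewrite !inE.
by case/andP => /eqP <- _; rewrite eqxx oX.
Qed.

(** The best item to drop is one that i values, if there is any. Otherwise the count is 0 and so is
    its truncated predecessor, which also matches the convention for an empty bundle. *)
Lemma ef1_envyE X i j :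
  ef1_envy v X i j = ((held X j i).-1%:Z - (held X i i)%:Z)%R.
Proof.
rewrite /ef1_envy !heldE.
have valD1 g : g \in bundle X j ->
    held X j i = v i g + bundle_val v i (bundle X j :\ g).
  by move=> gj; rewrite -heldE /bundle_val (big_setD1 g).
case: pickP => [g0 g0j | j0]; last first.
  suff -> : held X j i = 0 by rewrite /= sub0r.
  by apply/eqP; rewrite cards_eq0 -subset0; apply/subsetP => g; rewrite !inE;
     have := j0 g; rewrite !inE => ->.
case: arg_minP => // g gj gmin; congr (_ - _)%R; apply/eqP; rewrite eqz_nat.
have := valD1 _ gj; rewrite /edge_val; case: ifP => [ig | ig]; first by lia.
case: (posnP (held X j i)) => [-> | ]; first by lia.
rewrite card_gt0 => /set0Pn [h]; rewrite !inE => /andP [hj ih].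
have hj' : h \in bundle X j by rewrite inE.
have := valD1 _ hj'; have := gmin _ hj'; rewrite /edge_val ih.
by rewrite lerD2r lez_nat; lia.
Qed.

Lemma ef1_envy_le0 X i j :
  (ef1_envy v X i j <= 0)%R = (held X j i <= (held X i i).+1).
Proof. by rewrite ef1_envyE; lia. Qed.

Lemma held_transfer_out X g i k c : X g != i ->
  held (transfer X (g, i)) k c + ((k == X g) && (c \in ends g))
  = held X k c + ((k == i) && (c \in ends g)).
Proof.
move=> gi; rewrite /held (cardsD1 g [set h | (X h == k) && _])
  (cardsD1 g [set h | (_ h == k) && _]) !inE ffunE /= eqxx.
rewrite (eq_sym i k) (eq_sym (X g) k).
set A := (X in #|pred_of_set X|); set B := (X in _ = _ + #|pred_of_set X| + _).
have -> : A = B.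
  by apply/setP => h; rewrite !inE ffunE /=; case: (h == g).
lia.
Qed.

Lemma ends_transfer X g i : orientation v X -> i \in ends g -> i != X g ->
  ends g = [set X g; i].
Proof.
move=> /orientP oX ig ig'; apply/eqP; rewrite eq_sym eqEcard ends2 cards2 eq_sym ig' andbT.
by apply/subsetP => x; rewrite !inE => /orP [] /eqP ->.
Qed.

Lemma orientation_transfer X g i :
  orientation v X -> i \in ends g -> orientation v (transfer X (g, i)).
Proof. by move=> /orientP oX ig; apply/orientP => h; rewrite ffunE /=; case: eqP => // ->. Qed.

Lemma valid_transfer_safe X g i (j := X g) :
    orientation v X -> i \in ends g -> (forall k, held X k j <= held X j j) ->
    held X i j < held X j j -> valid_transfer v X (g, i).
Proof.
move=> oX ig safe lt_ij.
have ij : i != j by apply: contraTneq lt_ij => ->; rewrite ltnn.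
have eg := ends_transfer oX ig ij.
have jj_gt0 : 0 < held X j j by lia.
apply/and3P; split => //; last by apply/implyP => _; apply: orientation_transfer.
have hT := fun k c => @held_transfer_out X g i k c; rewrite eq_sym in ij.
apply/forallP => a; apply/forallP => b.
rewrite ef1_envy_le0 !ef1_envyE.
have := hT b a ij; have := hT a a ij; rewrite eg !inE -/j.
have := safe b.
have [-> | aj] := eqVneq a j.
  rewrite (negbTE ij) /=; case: (eqVneq b j) => [-> | bj]; rewrite ?(negbTE ij) /=; first by lia.
  by case: (eqVneq b i) => [-> | bi] /=; lia.
have [-> | ai] := eqVneq a i; last by lia.
rewrite /=; case: (eqVneq b j) => bj; case: (eqVneq b i) => [bi | bi]; rewrite ?bi ?bj /=; try lia.
Qed.

(** * Favourites, excess and climbs *)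

Definition favourite X c : 'I_n :=
  foldl (fun b k => if held X b c < held X k c then k else b) c (enum 'I_n).

Definition excess X c : nat := held X (favourite X c) c - held X c c.

Lemma favourite_max X c k : held X k c <= held X (favourite X c) c.
Proof.
rewrite /favourite; have : k \in enum 'I_n by rewrite mem_enum.
elim/last_ind: (enum 'I_n) => // s x IH.
rewrite mem_rcons inE foldl_rcons; case: ltnP => // le; case/orP => [/eqP -> // | /IH]; lia.
Qed.

Lemma favourite_self X c : favourite X c = c \/ held X c c < held X (favourite X c) c.
Proof.
rewrite /favourite; elim/last_ind: (enum 'I_n) => [|s x IH]; first by left.
by rewrite foldl_rcons; case: ltnP => // lt; right; case: IH => [e | ]; [rewrite e in lt | lia].
Qed.

(** Ties are broken by the enumeration alone, so a transfer of an item that c does not value leaves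
    the favourite of c unchanged. *)
Lemma favourite_ext X Y c :
  (forall k, held X k c = held Y k c) -> favourite X c = favourite Y c.
Proof.
move=> h; rewrite /favourite; elim/last_ind: (enum 'I_n) => // s x IH.
by rewrite !foldl_rcons IH !h.
Qed.

Lemma excess_ext X Y c : (forall k, held X k c = held Y k c) -> excess X c = excess Y c.
Proof. by move=> h; rewrite /excess (favourite_ext h) !h. Qed.

Lemma excessP X c e : reflect (forall k, held X k c <= held X c c + e) (excess X c <= e).
Proof.
rewrite /excess leq_subLR; apply: (iffP idP) => [h k | ->//].
exact: leq_trans (favourite_max X c k) h.
Qed.

Definition envious X c : bool := 1 < excess X c.

Lemma ef1_envious X : ef1 v X = [forall c, ~~ envious X c].
Proof.
apply: eq_forallb => c; rewrite -leqNgt.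
apply/forallP/excessP => h k; have := h k; rewrite ef1_envy_le0; lia.
Qed.

(* The end of the chain is a fixed point, so that |G| iterations reach it     *)
(* whatever its length.                                                       *)
Definition climb X c : 'I_n := if 0 < excess X (favourite X c) then favourite X c else c.

Lemma climb_eqVlt X c : orientation v X ->
  climb X c = c \/ held X c c < held X (climb X c) (climb X c).
Proof.
move=> oX; rewrite /climb; case: ifP => _; last by left.
case: (favourite_self X c) => [|h]; [by left | right].
exact: leq_trans h (held_le _ _ oX).
Qed.

Lemma iter_climb_eqVlt X c t : orientation v X ->
  iter t (climb X) c = c \/
  held X c c < held X (iter t (climb X) c) (iter t (climb X) c).
Proof.
move=> oX; elim: t => [|t IH] /=; first by left.
case: (climb_eqVlt (iter t (climb X) c) oX) => [-> // | h].
by right; case: IH => [e | lt]; [rewrite e in h * | exact: ltn_trans lt h].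
Qed.

Lemma held_max X k c : held X k c <= #|G|.
Proof. exact: max_card. Qed.

Definition summit X c : 'I_n := iter #|G| (climb X) c.

Lemma climb_summit X c : orientation v X -> climb X (summit X c) = summit X c.
Proof.
(* As long as the climb moves, the bundle size grows by at least one per move. It cannot exceed |G|,
   so after |G| iterations the chain is at rest. *)
move=> oX; suff H t : climb X (iter t (climb X) c) = iter t (climb X) c \/
    t < held X (iter t.+1 (climb X) c) (iter t.+1 (climb X) c).
  case: (H #|G|) => //; set b := iter #|G|.+1 _ _.
  by have := held_max X b b; lia.
elim: t => [|t IH] /=.
  by case: (climb_eqVlt c oX) => [|h]; [left | right; lia].
case: IH => [e|h]; first by left; rewrite /= !e.
case: (climb_eqVlt (iter t.+1 (climb X) c) oX) => [e|h']; first by left.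
by right; rewrite /= in h h' *; lia.
Qed.

Lemma excess_climb X c : 0 < excess X c -> 0 < excess X (climb X c).
Proof. by rewrite /climb; case: ifP. Qed.

Lemma excess_summit X c : 0 < excess X c -> 0 < excess X (summit X c).
Proof. by rewrite /summit => h; elim: #|G| => //= t; apply: excess_climb. Qed.

Lemma excess_favourite_summit X c : orientation v X -> 0 < excess X c ->
  excess X (favourite X (summit X c)) = 0.
Proof.
move=> oX /excess_summit; have := climb_summit c oX.
rewrite {1}/climb; case: (posnP (excess X _)) => // h e.
by rewrite /excess e subnn.
Qed.

(** A canonical choice that depends only on the set of envious agents: a transfer that preserves
    this set preserves the start of the climb. *)
Definition last_envious X : option 'I_n :=
  foldl (fun o c => if envious X c then Some c else o) None (enum 'I_n).

Lemma last_enviousP X :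
  if last_envious X is Some c then envious X c else ef1 v X.
Proof.
rewrite ef1_envious /last_envious.
set o := foldl _ _ _.
have : if o is Some c then envious X c else {in enum 'I_n, forall c, ~~ envious X c}.
  rewrite /o; elim/last_ind: (enum 'I_n) => //= s x; rewrite foldl_rcons.
  case: ifP => // ex; case: foldl => // IH c.
  by rewrite mem_rcons inE => /orP [/eqP -> | /IH //]; rewrite ex.
by case: o => // h; apply/forallP => c; apply: h; rewrite mem_enum.
Qed.

Lemma last_envious_ext X Y : envious X =1 envious Y -> last_envious X = last_envious Y.
Proof.
move=> h; rewrite /last_envious; elim/last_ind: (enum 'I_n) => // s x IH.
by rewrite !foldl_rcons IH h.
Qed.

(** * The potential *)

Definition squares X : nat := \sum_c held X c c ^ 2.

Lemma squares_le X : squares X <= #|G| ^ 2.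
Proof.
have sum_le : \sum_c held X c c <= #|G|.
  rewrite -[leqRHS]sum1_card (partition_big X xpredT) //=.
  apply: leq_sum => c _; rewrite sum1_card; apply/subset_leq_card/subsetP => g.
  by rewrite !inE => /andP [].
apply: leq_trans (_ : \sum_c #|G| * held X c c <= _).
  by apply: leq_sum => c _; rewrite leq_mul2r held_max orbT.
by rewrite -big_distrr /= leq_mul2l sum_le orbT.
Qed.

(** A lexicographic order packed into one number: bundle sizes are at most |G|, so a drop of
    [squares] outweighs any change of the second term. The successor makes the value 0 equivalent to
    EF1. *)
Definition potential X : nat :=
  if last_envious X is Some c then
    squares X * #|G|.+1 + (held X (summit X c) (summit X c)).+1
  else 0.

Lemma potential_lt X : potential X < #|G|.+2 ^ 3.
Proof.
rewrite /potential; case: last_envious => // c.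
have := held_max X (summit X c) (summit X c).
have := squares_le X; set A := squares X; set B := held _ _ _; move: #|G| => m.
by rewrite !expnS !expn0 => *; nia.
Qed.

(** * One transfer at the end of a climb *)

Section Step.

Variables (X : {ffun G -> 'I_n}) (e : 'I_n) (g : G).
Hypothesis oX : orientation v X.
Hypothesis envX : last_envious X = Some e.
Let i := summit X e.
Let j := favourite X i.
Hypothesis Xg : X g = j.
Hypothesis ig : i \in ends g.
Let Y := transfer X (g, i).

Let env_e : 1 < excess X e.
Proof. by have := last_enviousP X; rewrite envX. Qed.

Let exc_i : held X i i < held X j i.
Proof. by have := excess_summit (ltnW env_e); rewrite -/i {1}/excess -/j; lia. Qed.

Let exc_j : excess X j = 0.
Proof. exact: excess_favourite_summit (ltnW env_e). Qed.

Let ij : i != j.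
Proof. by apply: contraTneq exc_i => <-; rewrite ltnn. Qed.

Let eg : ends g = [set j; i].
Proof. by rewrite -Xg; apply: ends_transfer => //; rewrite Xg. Qed.

Let heldY k c :
  held Y k c + ((k == j) && ((c == j) || (c == i)))
  = held X k c + ((k == i) && ((c == j) || (c == i))).
Proof.
have /(held_transfer_out k c) : X g != i by rewrite Xg eq_sym.
by rewrite Xg eg !inE.
Qed.

Lemma valid_transfer_summit : valid_transfer v X (g, i).
Proof.
apply: valid_transfer_safe => //; rewrite Xg.
  by move=> k; rewrite -[leqRHS]addn0; apply: excessP; rewrite exc_j.
by apply: leq_ltn_trans (held_le _ _ oX) (leq_trans exc_i (held_le _ _ oX)).
Qed.

Let oY : orientation v Y := orientation_transfer oX ig.

Let squaresY : squares Y + 2 * held X j j = squares X + 2 * held X i i + 2.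
Proof.
have ji : j != i by rewrite eq_sym.
rewrite /squares (bigD1 i) // (bigD1 j) //= [in RHS](bigD1 i) // [in RHS](bigD1 j) //=.
have -> : \sum_(c | (c != i) && (c != j)) held Y c c ^ 2
        = \sum_(c | (c != i) && (c != j)) held X c c ^ 2.
  apply: eq_bigr => c /andP [/negbTE ci /negbTE cj].
  by have := heldY c c; rewrite ci cj /= !addn0 => ->.
have := heldY i i; have := heldY j j; rewrite !eqxx (negbTE ij) (negbTE ji) /=.
have := exc_i; have := held_le j i oX; rewrite !expnS !expn0 !muln1.
by move=> *; nia.
Qed.

Let held_other c k : c != i -> c != j -> held X k c = held Y k c.
Proof.
move=> /negbTE ci /negbTE cj.
by have := heldY k c; rewrite ci cj !andbF !addn0.
Qed.

Let excessY_i : excess X i = 1 -> excess Y i = 0.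
Proof.
move=> exi; apply/eqP; rewrite -leqn0; apply/excessP => k.
have ji : (i == j) = false by apply: negbTE.
have /excessP/(_ k) : excess X i <= 1 by rewrite exi.
have := heldY i i; have := heldY k i; rewrite !eqxx ji /= !andbT.
by case: (eqVneq k i) => [->|_]; rewrite ?ji //=; lia.
Qed.

Let excessY_j : excess Y j <= 1.
Proof.
have ji : (j == i) = false by rewrite eq_sym; apply: negbTE.
apply/excessP => k; have := heldY j j; have := heldY k j.
have /excessP/(_ k) : excess X j <= 0 by rewrite exc_j.
rewrite !eqxx ji /= !andbT.
case: (eqVneq k i) => [->|_]; last by lia.
by rewrite (negbTE ij); have := held_le i j oX; have := held_le j i oX; have := exc_i; lia.
Qed.

(** Neither i nor j is EF1-envious before or after the transfer, and the other agents do not value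
    g. *)
Let last_enviousY : excess X i = 1 -> last_envious Y = Some e.
Proof.
move=> exi; rewrite -envX; apply: last_envious_ext => c; rewrite /envious.
have [->|ci] := eqVneq c i; first by rewrite exi excessY_i.
have [->|cj] := eqVneq c j; first by rewrite exc_j; apply/negbTE; rewrite -leqNgt excessY_j.
by rewrite (excess_ext (Y := Y)) // => k; apply: held_other.
Qed.

(** Agents strictly before i on the old chain have bundles smaller than those of i and j, so their
    favourites are unchanged. The new climb thus follows the old chain, but cannot enter i, which is
    no longer restless. *)
Lemma summit_decrease : excess X i = 1 ->
  held Y (summit Y e) (summit Y e) < held X i i.
Proof.
move=> exi.
have lt_ij : held X i i < held X j j := leq_trans exc_i (held_le _ _ oX).
have below c : held X c c < held X i i -> c != i /\ c != j.
  by move=> h; split; apply: contraTneq h => ->; rewrite -leqNgt // ltnW.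
(* Q: c lies on the old chain, strictly before its end i.                   *)
pose Q c := held X c c < held X i i /\ exists t, iter t (climb X) c = i.
suff [lt _] : Q (summit Y e).
  by have [? ?] := below _ lt; rewrite -held_other.
have Qe : Q e.
  split; last by exists #|G|.
  case: (iter_climb_eqVlt e #|G| oX) => //; rewrite -/(summit X e) -/i => ei.
  by have := env_e; rewrite -ei exi.
rewrite {1}/summit; elim: #|G| => //= m [lt [t tE]].
set c := iter m _ _ in lt tE *.
have [ci cj] := below _ lt.
case: t tE => [/= /eqP|t]; first by rewrite (negbTE ci).
rewrite iterSr => tE.
(* If the old climb stayed at c, it would never reach i. *)
have fE : climb X c = favourite X c.
  rewrite /climb; case: ifP => // exf.
  have fix_c : climb X c = c by rewrite /climb exf.
  by move: ci; rewrite -tE fix_c iter_fix // eqxx.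
rewrite fE in tE; rewrite {1}/climb -(favourite_ext (fun k => held_other k ci cj)).
case: (eqVneq (favourite X c) i) => [fc|fi].
  by rewrite fc excessY_i //=; split=> //; exists t.+1; rewrite iterSr fE.
case: ifP => _; last by split=> //; exists t.+1; rewrite iterSr fE.
split; last by exists t.
case: (iter_climb_eqVlt (favourite X c) t oX); rewrite tE // => e'.
by rewrite e' eqxx in fi.
Qed.

Lemma potential_decrease : potential Y < potential X.
Proof.
rewrite /potential envX -/i.
have := exc_i; have := held_le j i oX; have := squaresY.
(* With excess 1 the squares do not grow and the second term drops. With a larger excess, j has at
   least two items more than i, so the squares themselves drop by [squaresY]. *)
case: (posnP (excess X i - 1)); rewrite {1}/excess -/j => exi.
  move=> sqY le_j lt_i.
  have exi1 : excess X i = 1 by rewrite /excess -/j; lia.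
  by rewrite last_enviousY //; have := summit_decrease exi1 => *; nia.
by case: last_envious => [c|] *; [have := held_max Y (summit Y c) (summit Y c)|]; nia.
Qed.

End Step.

End Multigraph.

(** * A language of bounded loops *)

(* The loop [LFor x y l] runs l as many times as the value of y on entry, and *)
(* uses x to count down; register 0 is scratch space.                         *)
Inductive loop : Type :=
| LConst of nat & nat
| LAdd of nat & nat & nat
| LSub of nat & nat & nat
| LLoad of nat & nat
| LStore of nat & nat
| LSeq of loop & loop
| LIf of nat & loop & loop
| LFor of nat & nat & loop.

Fixpoint compile (l : loop) : prog :=
  match l with
  | LConst x k => PConst x k
  | LAdd x y z => PAdd x y z
  | LSub x y z => PSub x y z
  | LLoad x y => PLoad x y
  | LStore x y => PStore x y
  | LSeq l1 l2 => PSeq (compile l1) (compile l2)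
  | LIf x l1 l2 => PIf x (compile l1) (compile l2)
  | LFor x y l1 =>
      PSeq (PConst 0 0) (PSeq (PAdd x y 0)
        (PWhile x (PSeq (compile l1) (PSeq (PConst 0 1) (PSub x x 0)))))
  end.

Definition for_init x y s :=
  let s' := set_reg s 0 0 in set_reg s' x (reg s' y + reg s' 0).

Definition for_next x s :=
  let s' := set_reg s 0 1 in set_reg s' x (reg s' x - reg s' 0).

(** Iteration counts are fixed on entry, so every loop program denotes a total function. Correctness
    is argued about it, and [run] enters only in [run_compile]. *)
Fixpoint sem (l : loop) (s : ram_state) : ram_state :=
  match l with
  | LConst x k => set_reg s x k
  | LAdd x y z => set_reg s x (reg s y + reg s z)
  | LSub x y z => set_reg s x (reg s y - reg s z)
  | LLoad x y => set_reg s x (mem s (reg s y))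
  | LStore x y => set_mem s (reg s x) (reg s y)
  | LSeq l1 l2 => sem l2 (sem l1 s)
  | LIf x l1 l2 => if reg s x != 0 then sem l1 s else sem l2 s
  | LFor x y l1 => iter (reg s y) (fun s' => for_next x (sem l1 s')) (for_init x y s)
  end.

Fixpoint writes (l : loop) : seq nat :=
  match l with
  | LConst x _ | LAdd x _ _ | LSub x _ _ | LLoad x _ => [:: x]
  | LStore _ _ => [::]
  | LSeq l1 l2 | LIf _ l1 l2 => writes l1 ++ writes l2
  | LFor x _ l1 => [:: 0, x & writes l1]
  end.

Fixpoint storeless (l : loop) : bool :=
  match l with
  | LStore _ _ => false
  | LSeq l1 l2 | LIf _ l1 l2 => storeless l1 && storeless l2
  | LFor _ _ l1 => storeless l1
  | _ => true
  end.

(** The bound must survive the clearing of register 0, and the body must not touch the counter. Then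
    the compiled [while] makes exactly the prescribed number of turns. *)
Fixpoint bounded_by (b : seq nat) (l : loop) : bool :=
  match l with
  | LSeq l1 l2 | LIf _ l1 l2 => bounded_by b l1 && bounded_by b l2
  | LFor x y l1 =>
      [&& y \in b, y != 0, x \notin 0 :: writes l1 & bounded_by b l1]
  | _ => true
  end.

Fixpoint weight (l : loop) : nat :=
  match l with
  | LSeq l1 l2 => weight l1 + weight l2
  | LIf _ l1 l2 => weight l1 + weight l2 + 1
  | LFor _ _ l1 => weight l1 + 6
  | _ => 1
  end.

Fixpoint depth (l : loop) : nat :=
  match l with
  | LSeq l1 l2 | LIf _ l1 l2 => depth l1 + depth l2
  | LFor _ _ l1 => (depth l1).+1
  | _ => 0
  end.

(** * Frames, running time and loop invariants *)

Lemma sem_reg l s x : x \notin writes l -> reg (sem l s) x = reg s x.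
Proof.
elim: l s => [y k|y z t|y z t|y z|y z|l1 IH1 l2 IH2|y l1 IH1 l2 IH2|y z l1 IH1] s //=.
- by rewrite inE => /negbTE ->.
- by rewrite inE => /negbTE ->.
- by rewrite inE => /negbTE ->.
- by rewrite inE => /negbTE ->.
- by rewrite mem_cat negb_or => /andP [h1 h2]; rewrite IH2 // IH1.
- by rewrite mem_cat negb_or => /andP [h1 h2]; case: ifP => _; [rewrite IH1|rewrite IH2].
- rewrite !inE !negb_or => /and3P [/negbTE x0 /negbTE xy h].
  by elim: (reg s z) => [|k IH] /=; rewrite ?xy ?x0 // IH1 // IH.
Qed.

Lemma sem_mem l s : storeless l -> mem (sem l s) = mem s.
Proof.
elim: l s => [y k|y z t|y z t|y z|y z|l1 IH1 l2 IH2|y l1 IH1 l2 IH2|y z l1 IH1] s //=.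
- by case/andP => h1 h2; rewrite IH2 // IH1.
- by case/andP => h1 h2; case: ifP => _; [rewrite IH1|rewrite IH2].
- by move=> h; elim: (reg s z) => //= k IH; rewrite IH1.
Qed.

Lemma run_compile (b : seq nat) N l s :
  0 < N -> bounded_by b l -> ~~ has [in b] (writes l) ->
  (forall y, y \in b -> reg s y <= N) ->
  exists2 t, t <= weight l * N ^ depth l & run (compile l) s t (sem l s).
Proof.
move=> N_gt0.
have N_exp d d' : d <= d' -> N ^ d <= N ^ d' by move=> ?; apply: leq_pexp2l.
have keep l1 s' : ~~ has [in b] (writes l1) ->
    (forall y, y \in b -> reg s' y <= N) -> forall y, y \in b -> reg (sem l1 s') y <= N.
  by move=> /hasPn h hs y yb; rewrite sem_reg ?hs //; apply/negP => /h /=; rewrite yb.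
elim: l s => [y k|y z t|y z t|y z|y z|l1 IH1 l2 IH2|y l1 IH1 l2 IH2|x y l1 IH1] s /=.
- by exists 1; last exact: RunConst.
- by exists 1; last exact: RunAdd.
- by exists 1; last exact: RunSub.
- by exists 1; last exact: RunLoad.
- by exists 1; last exact: RunStore.
- case/andP=> b1 b2; rewrite has_cat negb_or => /andP [w1 w2] hs.
  have [t1 le1 r1] := IH1 s b1 w1 hs.
  have [t2 le2 r2] := IH2 _ b2 w2 (keep _ _ w1 hs).
  exists (t1 + t2); last exact: RunSeq r1 r2.
  rewrite mulnDl leq_add //.
    by apply: leq_trans le1 _; rewrite leq_mul2l N_exp ?orbT ?leq_addr.
  by apply: leq_trans le2 _; rewrite leq_mul2l N_exp ?orbT ?leq_addl.
- case/andP=> b1 b2; rewrite has_cat negb_or => /andP [w1 w2] hs.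
  have N1 : 0 < N ^ (depth l1 + depth l2) by rewrite expn_gt0 N_gt0.
  rewrite !mulnDl mul1n; case: eqP => /= y0.
    have [t2 le2 r2] := IH2 s b2 w2 hs; exists t2.+1; last exact: RunIfFalse.
    have : weight l2 * N ^ depth l2 <= weight l2 * N ^ (depth l1 + depth l2).
      by rewrite leq_mul2l N_exp ?orbT ?leq_addl.
    by move: (weight l1 * _); lia.
  have [t1 le1 r1] := IH1 s b1 w1 hs; exists t1.+1; last by apply: RunIfTrue => //; apply/eqP.
  have : weight l1 * N ^ depth l1 <= weight l1 * N ^ (depth l1 + depth l2).
    by rewrite leq_mul2l N_exp ?orbT ?leq_addr.
  by move: (weight l2 * _); lia.
- case/and4P=> yb y0 xw b1; rewrite !negb_or => /and3P [b0 bx w1] hs.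
  pose body s' := for_next x (sem l1 s').
  (* Each turn costs the body plus 3 steps for the test and the decrement. With the 3 steps of
     set-up and exit this is what the 6 in [weight] absorbs. *)
  set w := PWhile x _; pose D := weight l1 * N ^ depth l1 + 3.
  have body_x s' : reg (body s') x = (reg s' x).-1.
    move: xw; rewrite inE negb_or => /andP [x0 xw].
    by rewrite /= eqxx (negbTE x0) sem_reg // subn1.
  have body_b s' : (forall y, y \in b -> reg s' y <= N) ->
      forall y, y \in b -> reg (body s') y <= N.
    move=> hs' z zb; have := keep _ _ w1 hs' z zb.
    have /negbTE zx : z != x by apply: contraNneq bx => <-.
    have /negbTE z0 : z != 0 by apply: contraNneq b0 => <-.
    by rewrite /= zx z0.
  have loopP k s' : (forall y, y \in b -> reg s' y <= N) -> reg s' x = k ->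
      exists2 t, t <= k * D + 1 & run w s' t (iter k body s').
    elim: k s' => [|k IH] s' hs' xk; first by exists 1 => //; apply: RunWhileFalse.
    have [t1 le1 r1] := IH1 s' b1 w1 hs'.
    have [||t2 le2 r2] := IH (body s'); [exact: body_b | by rewrite body_x xk |].
    exists ((t1 + (1 + 1)) + t2).+1; first by rewrite mulSn /D; lia.
    rewrite iterSr; apply: RunWhileTrue r2; first by rewrite xk.
    by apply: RunSeq r1 _; apply: RunSeq; [exact: RunConst | exact: RunSub].
  have [z zb||t le r] := loopP (reg s y) (for_init x y s).
  + have /negbTE zx : z != x by apply: contraNneq bx => <-.
    have /negbTE z0 : z != 0 by apply: contraNneq b0 => <-.
    by rewrite /= zx z0 hs.
  + by rewrite /= eqxx (negbTE y0) addn0.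
  exists (1 + (1 + t)); last by do 2!(apply: RunSeq; first by constructor).
  have ND1 : 0 < N ^ depth l1 by rewrite expn_gt0 N_gt0.
  have := hs y yb; rewrite /D in le; rewrite expnS.
  have := N_gt0; move: le ND1; move: (reg s y) (weight l1) (N ^ depth l1) => k W P *; nia.
Qed.

Definition frame l s s' : Prop :=
  (forall z, z \notin writes l -> reg s' z = reg s z) /\
  (storeless l -> mem s' = mem s).

Lemma frame_sem l s : frame l s (sem l s).
Proof. by split=> [z /sem_reg -> | /sem_mem ->]. Qed.

(** The frame comes for free at every turn, so invariants mention only what the body changes. *)
Lemma for_ind (I : nat -> ram_state -> Prop) x y l s :
  I 0 (for_init x y s) ->
  (forall k s', k < reg s y -> frame (LFor x y l) s s' ->
     I k s' -> I k.+1 (for_next x (sem l s'))) ->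
  I (reg s y) (sem (LFor x y l) s).
Proof.
move=> I0 IS /=; suff H k : k <= reg s y ->
    let s' := iter k (fun s' => for_next x (sem l s')) (for_init x y s) in
    frame (LFor x y l) s s' /\ I k s' by case: (H (reg s y)).
elim: k => [_|k IH lt] /=.
  split=> //; split=> // z; rewrite !inE !negb_or => /and3P [/negbTE z0 /negbTE zx _] /=.
  by rewrite zx z0.
have [[Jr Jm] JI] := IH (ltnW lt); split; last exact: IS.
split=> [z hz | hl /=]; last by rewrite sem_mem // Jm.
have := hz; rewrite !inE !negb_or => /and3P [/negbTE z0 /negbTE zx hl] /=.
by rewrite zx z0 sem_reg // Jr.
Qed.

Lemma semSeq l1 l2 s : sem (LSeq l1 l2) s = sem l2 (sem l1 s).
Proof. by []. Qed.

Lemma semIfT x l1 l2 s : reg s x != 0 -> sem (LIf x l1 l2) s = sem l1 s.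
Proof. by move=> /= ->. Qed.

Lemma semIfF x l1 l2 s : reg s x = 0 -> sem (LIf x l1 l2) s = sem l2 s.
Proof. by move=> /= ->. Qed.

(** * The algorithm *)

Notation rN := 1 (only parsing).
Notation rM := 2 (only parsing).
Notation rL := 3 (only parsing).
Notation rOne := 4 (only parsing).
Notation rTwo := 5 (only parsing).
Notation rBase := 6 (only parsing).
Notation rLen := 7 (only parsing).
Notation rOut := 8 (only parsing).
Notation rK := 10 (only parsing).
Notation rC := 11 (only parsing).
Notation rHeld := 12 (only parsing).
Notation rAddr := 13 (only parsing).
Notation rX := 14 (only parsing).
Notation rY := 15 (only parsing).
Notation rZ := 16 (only parsing).
Notation rTmp := 17 (only parsing).
Notation rI := 18 (only parsing).
Notation rIdx := 19 (only parsing).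
Notation rItem := 20 (only parsing).
Notation rFav := 21 (only parsing).
Notation rMax := 22 (only parsing).
Notation rOwn := 23 (only parsing).
Notation rJ := 24 (only parsing).
Notation rExc := 25 (only parsing).
Notation rFound := 26 (only parsing).
Notation rEnv := 27 (only parsing).
Notation rP := 28 (only parsing).
Notation rCur := 29 (only parsing).
Notation rNxt := 30 (only parsing).
Notation rQ := 31 (only parsing).
Notation rSrc := 32 (only parsing).
Notation rDst := 33 (only parsing).

Notation "l1 ;; l2" := (LSeq l1 l2) (at level 60, right associativity).

Definition l_skip := LConst 0 0.
Definition l_move x y := LConst 0 0 ;; LAdd x y 0.
(** The absolute difference, as a sum of two truncated differences of which one is 0. *)
Definition l_dist x y := LSub rTmp y x ;; LSub x x y ;; LAdd x x rTmp.

(* Sets rX to a number that vanishes iff the item at rAddr is owned by rK and *)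
(* has rC as an endpoint: |owner - rK| + min(|end1 - rC|, |end2 - rC|), where *)
(* min(y, z) = y - (y - z).                                                   *)
Definition l_fetch :=
  LLoad rX rAddr ;; LAdd rAddr rAddr rOne ;;
  LLoad rY rAddr ;; LAdd rAddr rAddr rOne ;;
  LLoad rZ rAddr ;; LAdd rAddr rAddr rOne ;;
  l_dist rX rK ;; l_dist rY rC ;; l_dist rZ rC ;;
  LSub rTmp rY rZ ;; LSub rY rY rTmp ;; LAdd rX rX rY.

Definition l_held :=
  LConst rHeld 0 ;; LConst rAddr 2 ;; LConst rIdx 0 ;;
  LFor rI rM
    (l_fetch ;;
     LIf rX l_skip (LAdd rHeld rHeld rOne ;; l_move rItem rIdx) ;;
     LAdd rIdx rIdx rOne).

Definition l_favourite :=
  l_move rK rC ;; l_held ;;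
  l_move rFav rC ;; l_move rMax rHeld ;; l_move rOwn rHeld ;; LConst rK 0 ;;
  LFor rJ rN
    (l_held ;; LSub rTmp rHeld rMax ;;
     LIf rTmp (l_move rFav rK ;; l_move rMax rHeld) l_skip ;;
     LAdd rK rK rOne) ;;
  LSub rExc rMax rOwn.

Definition l_last_envious :=
  LConst rFound 0 ;; LConst rC 0 ;;
  LFor rP rN
    (l_favourite ;; LSub rTmp rExc rOne ;;
     LIf rTmp (LConst rFound 1 ;; l_move rEnv rC) l_skip ;;
     LAdd rC rC rOne).

(** Invariant: [rNxt] is the favourite of [rCur]. The call made to test whether it is restless also
    yields its own favourite, ready for the next turn. *)
Definition l_summit :=
  l_move rCur rEnv ;; l_move rC rCur ;; l_favourite ;; l_move rNxt rFav ;;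
  LFor rQ rM
    (l_move rC rNxt ;; l_favourite ;;
     LIf rExc (l_move rCur rNxt ;; l_move rNxt rFav) l_skip).

Definition l_transfer :=
  l_move rK rNxt ;; l_move rC rCur ;; l_held ;;
  LAdd rAddr rItem rItem ;; LAdd rAddr rAddr rItem ;; LAdd rAddr rAddr rTwo ;;
  LStore rAddr rCur ;;
  LStore rOut rItem ;; LAdd rOut rOut rOne ;;
  LStore rOut rCur ;; LAdd rOut rOut rOne ;;
  LAdd rLen rLen rOne.

Definition l_step := l_last_envious ;; LIf rFound (l_summit ;; l_transfer) l_skip.

(* The output is built from address rBase = 2 + 3 |G| on, past the input, and *)
(* moved to address 0 at the end.                                             *)
Definition l_init :=
  LLoad rN 0 ;; LConst rOne 1 ;; LLoad rM rOne ;; LConst rTwo 2 ;;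
  LAdd rL rM rTwo ;; LAdd rBase rM rM ;; LAdd rBase rBase rL ;;
  LAdd rOut rBase rOne ;; LConst rLen 0.

(* Copies (|G| + 2)^4 words, more than the output ever takes.                 *)
Definition l_copy :=
  LStore rBase rLen ;; LConst rDst 0 ;; l_move rSrc rBase ;;
  LFor 34 rL (LFor 35 rL (LFor 36 rL (LFor 37 rL
    (LLoad rTmp rSrc ;; LStore rDst rTmp ;;
     LAdd rSrc rSrc rOne ;; LAdd rDst rDst rOne)))).

Definition l_main := LFor 34 rL (LFor 35 rL (LFor 36 rL l_step)) ;; l_copy.


(** * The programs compute the functions above *)

Section Correctness.

Variables (n : nat) (G : finType) (ends : G -> {set 'I_n}).

Implicit Types (X : {ffun G -> 'I_n}) (c k : 'I_n) (g : G).

Notation v := (edge_val ends).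
Notation held := (held ends).

Definition rank (g : G) : nat := enum_rank g.

Definition stored X (M : nat -> nat) : Prop := forall g,
  M (2 + 3 * rank g) = X g /\
  forall c, (c \in ends g) = (M (3 + 3 * rank g) == c) || (M (4 + 3 * rank g) == c).

Definition consts s : Prop :=
  [/\ reg s rN = n, reg s rM = #|G|, reg s rL = #|G|.+2, reg s rOne = 1
    & reg s rTwo = 2].

Lemma consts_frame l s s' : ~~ has [in [:: rN; rM; rL; rOne; rTwo]] (writes l) ->
  frame l s s' -> consts s -> consts s'.
Proof.
move/hasPn => h [fr _] [c1 c2 c3 c4 c5].
by split; rewrite fr //; apply/negP => /h.
Qed.

Lemma l_fetchP X s g k c : stored X (mem s) -> reg s rOne = 1 ->
  reg s rK = k -> reg s rC = c -> reg s rAddr = 2 + 3 * rank g ->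
  (reg (sem l_fetch s) rX == 0) = (X g == k) && (c \in ends g) /\
  reg (sem l_fetch s) rAddr = 2 + 3 * (rank g).+1.
Proof.
move=> st one kE cE aE; rewrite /l_fetch /= one kE cE aE.
have [-> ->] := st g.
have -> : 2 + 3 * rank g + 1 = 3 + 3 * rank g by lia.
have -> : 3 + 3 * rank g + 1 = 4 + 3 * rank g by lia.
split; last by lia.
move: (mem s _) (mem s (4 + _)) => y z.
by rewrite -val_eqE /=; lia.
Qed.

(** Besides counting, the loop leaves in [rItem] the last item counted, which is the item that
    [l_transfer] moves. *)
Lemma l_heldP X s k c : consts s -> stored X (mem s) -> reg s rK = k -> reg s rC = c ->
  reg (sem l_held s) rHeld = held X k c /\
  (0 < held X k c -> exists g, [/\ X g = k, c \in ends g & reg (sem l_held s) rItem = rank g]).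
Proof.
move=> cs st kE cE; rewrite /l_held !semSeq.
set s1 := sem (LConst 19 0) _.
pose S (j : nat) := [set g | [&& X g == k, c \in ends g & rank g < j]].
pose I j s' := [/\ reg s' rAddr = 2 + 3 * j, reg s' rIdx = j, reg s' rHeld = #|S j|
  & 0 < #|S j| -> exists g, [/\ X g = k, c \in ends g & reg s' rItem = rank g]].
have [_ mE _ oneE _] := cs.
have -> : held X k c = #|S #|G| |.
  by rewrite /held; apply: eq_card => g; rewrite !inE ltn_ord andbT.
set sF := sem (LFor _ _ _) s1; suff [_ _ -> h] : I #|G| sF by split=> //; exact: h.
rewrite -{1}mE -[reg s rM]/(reg s1 rM); apply: (for_ind (I := I)).
  rewrite /I /= /S; have -> : [set g | [&& X g == k, c \in ends g & rank g < 0]] = set0.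
    by apply/setP => g; rewrite !inE ltn0 !andbF.
  by rewrite cards0.
move=> j s' jm; rewrite {1}/s1 /= mE in jm.
move=> [fr frm] [aE iE hE itE].
have gj : exists g, rank g = j by exists (enum_val (Ordinal jm)); rewrite /rank enum_valK.
have [g gE] := gj.
have ms' : mem s' = mem s by rewrite frm.
have rs' z : z \in [:: rOne; rK; rC] -> reg s' z = reg s z.
  by rewrite !inE => /or3P [] /eqP ->; rewrite fr.
rewrite 2!semSeq; set s2 := sem l_fetch s'.
have [] := @l_fetchP X s' g k c; rewrite ?ms' ?gE //; try by rewrite rs'.
rewrite -/s2 => xE aE2.
have iE2 : reg s2 rIdx = j by rewrite sem_reg.
have hE2 : reg s2 rHeld = #|S j| by rewrite sem_reg.
have itE2 : reg s2 rItem = reg s' rItem by rewrite sem_reg.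
have oneE2 : reg s2 rOne = 1 by rewrite sem_reg // rs'.
have SE : #|S j.+1| = ((X g == k) && (c \in ends g)) + #|S j|.
  rewrite (cardsD1 g) inE gE ltnS leqnn andbT; congr (_ + _).
  apply: eq_card => h; rewrite !inE ltnS leq_eqVlt -gE.
  have -> : (rank h == rank g) = (h == g) by rewrite /rank val_eqE (inj_eq enum_rank_inj).
  by case: eqVneq => [->|] //=; rewrite ltnn !andbF.
rewrite /I SE.
move: s2 iE2 hE2 itE2 oneE2 xE aE2 => s2 iE2 hE2 itE2 oneE2.
case: eqP => [x0|/eqP x0] hit aE2; rewrite -hit.
  rewrite semIfF //= oneE2 iE2 hE2 !addn1 add1n; split=> // _; exists g.
  by move/esym/andP: hit => [/eqP -> ->]; rewrite addn0.
by rewrite semIfT //= oneE2 iE2 hE2 itE2 !addn1 add0n; split.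
Qed.

Lemma l_favouriteP X s c : consts s -> stored X (mem s) -> reg s rC = c ->
  reg (sem l_favourite s) rFav = favourite ends X c /\
  reg (sem l_favourite s) rExc = excess ends X c.
Proof.
move=> cs st cE; rewrite /l_favourite 7!semSeq.
set s1 := sem (LConst rK 0) _.
have : [/\ consts s1, stored X (mem s1), reg s1 rC = c
    & [/\ reg s1 rK = 0, reg s1 rFav = c, reg s1 rMax = held X c c & reg s1 rOwn = held X c c]].
  rewrite /s1; set s0 := sem l_held _.
  have fr : frame (l_move rK rC ;; l_held) s s0 := frame_sem _ s.
  have cs0 : consts s0 by apply: consts_frame fr _.
  have st0 : stored X (mem s0) by rewrite fr.2.
  have cE0 : reg s0 rC = c by rewrite fr.1.
  have hE0 : reg s0 rHeld = held X c c.
    rewrite /s0; set s0' := sem _ s.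
    have fr' : frame (l_move rK rC) s s0' := frame_sem _ s.
    have kE : reg s0' rK = c by rewrite /= addn0.
    have cE' : reg s0' rC = c by rewrite fr'.1.
    have cs0' : consts s0' by apply: consts_frame fr' _.
    have st0' : stored X (mem s0') by rewrite fr'.2.
    by have [] := l_heldP cs0' st0' kE cE'.
  by move: (s0) cs0 st0 cE0 hE0 => s2 cs2 st2 cE2 hE2; rewrite /= cE2 hE2 !addn0.
move: s1 => s1 [cs1 st1 cE1 [kE1 fE1 mE1 oE1]].
pose upd b k := if held X b c < held X k c then k else b.
pose fav j := foldl upd c (take j (enum 'I_n)).
pose I j s' := [/\ reg s' rK = j, reg s' rFav = fav j, reg s' rMax = held X (fav j) c
  & reg s' rOwn = held X c c].
set sF := sem (LFor _ _ _) s1.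
have {}fE : I n sF.
  have [nE1 _ _ _ _] := cs1; rewrite -{1}nE1; apply: (for_ind (I := I)).
    by rewrite /I /fav take0.
  rewrite nE1 => j s' jn fr [kE fE mE oE].
  have cs' : consts s' by apply: consts_frame fr _.
  have st' : stored X (mem s') by rewrite fr.2.
  have cE' : reg s' rC = c by rewrite fr.1.
  have [hE _] := @l_heldP X s' (Ordinal jn) c cs' st' kE cE'.
  have favS : fav j.+1 = upd (fav j) (Ordinal jn).
    rewrite /fav (take_nth (Ordinal jn)) ?size_enum_ord // foldl_rcons.
    by rewrite (_ : nth _ _ _ = Ordinal jn) //; apply: val_inj; rewrite /= nth_enum_ord.
  rewrite 2!semSeq /I favS /upd; set s2 := sem l_held s' in hE *.
  have fr2 : frame l_held s' s2 := frame_sem _ s'.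
  have [kE2 fE2 mE2 oE2] : [/\ reg s2 rK = j, reg s2 rFav = fav j,
      reg s2 rMax = held X (fav j) c & reg s2 rOwn = held X c c].
    by split; rewrite fr2.1.
  have oneE2 : reg s2 rOne = 1 by have [] := consts_frame _ fr2 cs'.
  move: s2 fr2 hE kE2 fE2 mE2 oE2 oneE2 => s2 _ hE kE2 fE2 mE2 oE2 oneE2.
  rewrite semSeq; case: ltnP => cmp.
    rewrite semIfT /=; last by rewrite hE mE2 subn_eq0 -ltnNge.
    by rewrite hE kE2 oE2 oneE2 addn1 !addn0.
  rewrite semIfF /=; last by apply/eqP; rewrite hE mE2 subn_eq0.
  by rewrite kE2 fE2 mE2 oE2 oneE2 addn1.
have [_ fE2 mE2 oE2] := fE; have favE : fav n = favourite ends X c.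
  by rewrite /fav take_oversize // size_enum_ord.
move: sF fE2 mE2 oE2 {fE} => sF fE2 mE2 oE2.
by rewrite /= fE2 mE2 oE2 favE.
Qed.

Lemma l_last_enviousP X s : consts s -> stored X (mem s) ->
  if last_envious ends X is Some c then
    reg (sem l_last_envious s) rFound = 1 /\ reg (sem l_last_envious s) rEnv = c
  else reg (sem l_last_envious s) rFound = 0.
Proof.
move=> cs st; rewrite /l_last_envious 2!semSeq; set s1 := sem _ (sem _ s).
have : [/\ consts s1, stored X (mem s1), reg s1 rFound = 0 & reg s1 rC = 0] by [].
move: s1 => s1 [cs1 st1 fE1 cE1].
pose upd o c := if envious ends X c then Some c else o.
pose env j := foldl upd None (take j (enum 'I_n)).
pose I j s' := reg s' rC = j /\
  if env j is Some c then reg s' rFound = 1 /\ reg s' rEnv = c else reg s' rFound = 0.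
set sF := sem (LFor _ _ _) s1.
have : I n sF.
  have [nE1 _ _ _ _] := cs1; rewrite -{1}nE1; apply: (for_ind (I := I)).
    by rewrite /I /env take0.
  rewrite nE1 => j s' jn fr [cE eE].
  have cs' : consts s' by apply: consts_frame fr _.
  have st' : stored X (mem s') by rewrite fr.2.
  have [_ xE] := @l_favouriteP X s' (Ordinal jn) cs' st' cE.
  have envS : env j.+1 = upd (env j) (Ordinal jn).
    rewrite /env (take_nth (Ordinal jn)) ?size_enum_ord // foldl_rcons.
    by rewrite (_ : nth _ _ _ = Ordinal jn) //; apply: val_inj; rewrite /= nth_enum_ord.
  rewrite 2!semSeq /I envS /upd /envious; set s2 := sem l_favourite s' in xE *.
  have fr2 : frame l_favourite s' s2 := frame_sem _ s'.
  have cE2 : reg s2 rC = j by rewrite fr2.1.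
  have eE2 : if env j is Some c then reg s2 rFound = 1 /\ reg s2 rEnv = c
             else reg s2 rFound = 0.
    by move: eE; case: (env j) => [b [e1 e2]|e1]; [split|]; rewrite fr2.1.
  have oneE2 : reg s2 rOne = 1 by have [] := consts_frame _ fr2 cs'.
  move: s2 fr2 xE cE2 eE2 oneE2 => s2 _ xE cE2 eE2 oneE2.
  rewrite semSeq; case: ltnP => cmp.
    rewrite semIfT /=; last by rewrite xE oneE2 subn_eq0 -ltnNge.
    by rewrite cE2 oneE2 addn1 addn0.
  rewrite semIfF /=; last by apply/eqP; rewrite xE oneE2 subn_eq0.
  by rewrite cE2 oneE2 addn1; split=> //; case: (env j) eE2.
by case=> _; rewrite /env take_oversize // size_enum_ord.
Qed.

Lemma l_summitP X s c : consts s -> stored X (mem s) -> reg s rEnv = c ->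
  reg (sem l_summit s) rCur = summit ends X c /\
  reg (sem l_summit s) rNxt = favourite ends X (summit ends X c).
Proof.
move=> cs st eE; rewrite /l_summit 4!semSeq.
set s1 := sem (l_move rNxt rFav) _.
have : [/\ consts s1, stored X (mem s1), reg s1 rCur = c & reg s1 rNxt = favourite ends X c].
  rewrite /s1; set s0 := sem _ s; set s0' := sem _ s0; set s2 := sem l_favourite s0'.
  have fr : frame (l_move rCur rEnv ;; l_move rC rCur) s s0' := frame_sem _ s.
  have fr2 : frame l_favourite s0' s2 := frame_sem _ s0'.
  have cs' : consts s0' by apply: consts_frame fr _.
  have st' : stored X (mem s0') by rewrite fr.2.
  have cE' : reg s0' rC = c by rewrite /= eE !addn0.
  have [fE _] := l_favouriteP cs' st' cE'.
  have cs2 : consts s2 by apply: consts_frame fr2 _.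
  have st2 : stored X (mem s2) by rewrite fr2.2.
  have cur2 : reg s2 rCur = c by rewrite fr2.1 //= eE addn0.
  rewrite -/s2 in fE.
  by move: (s2) cs2 st2 fE cur2 => s3 cs3 st3 fE cur3; rewrite /= fE cur3 addn0.
move: s1 => s1 [cs1 st1 cE1 nE1].
pose I j s' := reg s' rCur = iter j (climb ends X) c /\
  reg s' rNxt = favourite ends X (iter j (climb ends X) c).
rewrite /summit; set sF := sem (LFor _ _ _) s1; suff : I #|G| sF by [].
have [_ mE1 _ _ _] := cs1; rewrite -{1}mE1; apply: (for_ind (I := I)) => //.
move=> j s' _ fr [cE nE].
rewrite semSeq /I iterS; move: (iter j _ _) cE nE => b cE nE.
set s2 := sem _ s'; have fr2 : frame (l_move rC rNxt) s' s2 := frame_sem _ s'.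
have cs' : consts s' by apply: consts_frame fr _.
have st' : stored X (mem s') by rewrite fr.2.
have cs2 : consts s2 by apply: consts_frame fr2 _.
have st2 : stored X (mem s2) by rewrite fr2.2.
have cE2 : reg s2 rC = favourite ends X b by rewrite /= nE addn0.
rewrite semSeq; have [fE xE] := l_favouriteP cs2 st2 cE2.
set s3 := sem l_favourite s2 in fE xE *.
have fr3 : frame (l_move rC rNxt ;; l_favourite) s' s3 := frame_sem _ s'.
have cE3 : reg s3 rCur = b by rewrite fr3.1.
have nE3 : reg s3 rNxt = favourite ends X b by rewrite fr3.1.
move: s3 fr3 fE xE cE3 nE3 => s3 _ fE xE cE3 nE3.
rewrite /climb; case: ltnP => cmp.
  by rewrite semIfT ?xE -?lt0n //= fE nE3 !addn0.
by rewrite semIfF /= ?cE3 ?nE3 // xE; apply/eqP; rewrite -leqn0.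
Qed.

Definition base : nat := 2 + 3 * #|G|.

Definition code (ts : seq (G * 'I_n)) : seq nat :=
  flatten [seq [:: val (enum_rank t.1); val t.2] | t <- ts].

Lemma size_code ts : size (code ts) = 2 * size ts.
Proof. by elim: ts => //= t ts IH; rewrite IH; lia. Qed.

Lemma code_rcons ts t : code (rcons ts t) = code ts ++ [:: val (enum_rank t.1); val t.2].
Proof. by rewrite /code map_rcons flatten_rcons. Qed.

Definition emitted (ts : seq (G * 'I_n)) s : Prop :=
  [/\ reg s rBase = base, reg s rLen = size ts, reg s rOut = base + 1 + 2 * size ts
    & forall a, a < 2 * size ts -> mem s (base + 1 + a) = nth 0 (code ts) a].

Lemma emitted_frame l s s' ts : ~~ has [in [:: rBase; rLen; rOut]] (writes l) ->
  storeless l -> frame l s s' -> emitted ts s -> emitted ts s'.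
Proof.
move/hasPn => h nl [fr frm] [c1 c2 c3 c4].
by split; rewrite ?frm // fr //; apply/negP => /h.
Qed.

Lemma l_transferP X s ts (i j : 'I_n) : consts s -> stored X (mem s) -> emitted ts s ->
  reg s rCur = i -> reg s rNxt = j -> 0 < held X j i ->
  exists g, [/\ X g = j, i \in ends g, consts (sem l_transfer s),
    stored (transfer X (g, i)) (mem (sem l_transfer s))
    & emitted (rcons ts (g, i)) (sem l_transfer s)].
Proof.
move=> cs st em iE jE held_gt0; rewrite /l_transfer 3!semSeq.
set s0 := sem _ (sem _ s); set s1 := sem l_held s0.
have fr0 : frame (l_move rK rNxt ;; l_move rC rCur) s s0 := frame_sem _ s.
have fr1 : frame l_held s0 s1 := frame_sem _ s0.
have cs0 : consts s0 by apply: consts_frame fr0 _.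
have st0 : stored X (mem s0) by rewrite fr0.2.
have kE0 : reg s0 rK = j by rewrite /= jE addn0.
have cE0 : reg s0 rC = i by rewrite /= iE addn0.
have [_ /(_ held_gt0) [g [gj ig gE]]] := l_heldP cs0 st0 kE0 cE0.
rewrite -/s1 in gE.
have cs1 : consts s1 by apply: consts_frame fr1 _.
have st1 : stored X (mem s1) by rewrite fr1.2.
have em1 : emitted ts s1 by apply: emitted_frame fr1 _ => //; apply: emitted_frame fr0 _.
have iE1 : reg s1 rCur = i by rewrite fr1.1 // fr0.1.
move: s1 fr1 gE cs1 st1 em1 iE1 => s1 _ gE cs1 st1 [bE lE oE outE] iE1.
have [nE mE LE oneE twoE] := cs1; exists g; split=> //=.
  move=> h; rewrite gE iE1 oE oneE twoE /=.
  have hm : rank h < #|G| := ltn_ord _.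
  have [h1 h2] := st1 h; rewrite /base.
  (* The output is written past [base], and the only input cell overwritten is the owner of g, so
     all endpoints survive. *)
  split=> [|c]; last by rewrite !ifF ?h2 //; apply/eqP; lia.
  rewrite ifF; last by apply/eqP; lia.
  rewrite ifF; last by apply/eqP; lia.
  rewrite ffunE /=; case: (eqVneq h g) => [->|hg]; first by rewrite ifT //; apply/eqP; lia.
  rewrite ifF // ; apply/eqP => e; have rg : rank h = rank g by lia.
  by move/eqP: hg; apply; apply/enum_rank_inj/val_inj.
have gm : rank g < #|G| := ltn_ord _.
split; rewrite //= ?gE ?iE1 ?oE ?oneE ?twoE ?lE ?size_rcons; try lia.
move=> a lt_a; rewrite code_rcons nth_cat size_code.
case: ltnP => cmp.
  by rewrite !ifF ?outE //; apply/eqP; rewrite /base; lia.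
have [-> | ->] : a = 2 * size ts \/ a = (2 * size ts).+1 by lia.
  by rewrite ifF ?ifT ?subnn //; apply/eqP; lia.
by rewrite ifT ?subSnn //; apply/eqP; lia.
Qed.

End Correctness.

(** * Correctness and running time *)

(* The registers from 34 on are the counters of the outer loops.              *)
Definition stable (P : nat -> ram_state -> Prop) : Prop := forall k s s',
  (forall z, 0 < z < 34 -> reg s' z = reg s z) -> mem s' = mem s ->
  P k s -> P k s'.

(** Applied to itself, it multiplies the progress of a body by N for each nested loop. Stability
    lets P ignore the counters and the scratch register. *)
Lemma for_shift (P : nat -> ram_state -> Prop) N x l d :
  stable P -> 33 < x -> (forall k s, P k s -> reg s rL = N) ->
  (forall k s, P k s -> P (k + d) (sem l s)) ->
  forall k s, P k s -> P (k + N * d) (sem (LFor x rL l) s).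
Proof.
move=> stP x33 NP lP k s Pks; rewrite -{1}(NP k s Pks).
have xz z : 0 < z < 34 -> (z == x) = false /\ (z == 0) = false by lia.
apply: (for_ind (I := fun j s' => P (k + j * d) s')).
  by rewrite mul0n addn0; apply: stP Pks => // z /xz [/= -> ->].
move=> j s' _ _ Ps'; rewrite mulSn addnCA addnC.
by apply: stP (lP _ _ Ps') => // z /xz [/= -> ->].
Qed.

Section Run.

Variables (n : nat) (G : finType) (ends : G -> {set 'I_n}).
Hypothesis ends2 : forall g : G, #|ends g| = 2.

Notation v := (edge_val ends).
Notation transfer := (@transfer n G).

Lemma valid_transfers_rcons (X : {ffun G -> 'I_n}) ts t :
  valid_transfers v X (rcons ts t)
  = valid_transfers v X ts && valid_transfer v (foldl transfer X ts) t.
Proof. by elim: ts X => [|t' ts IH] X /=; rewrite ?andbT // IH andbA. Qed.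

Lemma scanl_rcons T1 T2 (f : T1 -> T2 -> T1) x s y :
  scanl f x (rcons s y) = rcons (scanl f x s) (foldl f x (rcons s y)).
Proof. by elim: s x => //= z s IH x; rewrite IH. Qed.

(** The subtraction truncates: once the potential is 0, further steps idle. The last inequality on
    the potential bounds the length of the output. *)
Definition reached (X0 : {ffun G -> 'I_n}) k s : Prop := exists ts,
  let X := foldl transfer X0 ts in
  [/\ valid_transfers v X0 ts, all (orientation v) (scanl transfer X0 ts),
      orientation v X, potential ends X <= potential ends X0 - k
    & size ts + potential ends X <= potential ends X0] /\
  [/\ consts n G s, stored ends X (mem s) & emitted ts s].

Lemma reached_stable X0 : stable (reached X0).
Proof.
move=> k s s' rs ms [ts [H [[c1 c2 c3 c4 c5] st [e1 e2 e3 e4]]]].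
by exists ts; split=> //; split; rewrite ?ms // /consts /emitted ?ms !rs //; split.
Qed.

Lemma l_stepP X0 k s : reached X0 k s -> reached X0 (k + 1) (sem l_step s).
Proof.
move=> [ts []]; set X := foldl _ _ _ => -[vts ots oX potX szX] [cs st em].
rewrite /l_step semSeq; set s1 := sem l_last_envious s.
have fr1 : frame l_last_envious s s1 := frame_sem _ s.
have cs1 : consts n G s1 by apply: consts_frame fr1 _.
have st1 : stored ends X (mem s1) by rewrite fr1.2.
have em1 : emitted ts s1 by apply: emitted_frame fr1 _.
have := l_last_enviousP cs st; rewrite -/s1; case envX: last_envious => [e|]; last first.
  move=> f0; rewrite semIfF //.
  have pot0 : potential ends X = 0 by rewrite /potential envX.
  by exists ts; split; [split; rewrite -/X ?pot0 //; rewrite pot0 in szX | split].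
case=> f1 eE; rewrite semIfT ?f1 // semSeq; set s2 := sem l_summit s1.
have fr2 : frame l_summit s1 s2 := frame_sem _ s1.
have cs2 : consts n G s2 by apply: consts_frame fr2 _.
have st2 : stored ends X (mem s2) by rewrite fr2.2.
have em2 : emitted ts s2 by apply: emitted_frame fr2 _.
have [cE nE] := l_summitP cs1 st1 eE.
have exc : 0 < excess ends X (summit ends X e).
  by apply: excess_summit; have := last_enviousP ends X; rewrite envX; apply: ltnW.
have held_gt0 : 0 < held ends X (favourite ends X (summit ends X e)) (summit ends X e).
  by move: exc; rewrite /excess subn_gt0; apply: leq_trans.
have [g [gj ig cs3 st3 em3]] := l_transferP cs2 st2 em2 cE nE held_gt0.
have vt := valid_transfer_summit ends2 oX envX gj ig.
have := potential_decrease ends2 oX envX gj ig.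
have oY := orientation_transfer oX ig.
exists (rcons ts (g, summit ends X e)); rewrite foldl_rcons -/X; split; split=> //.
- by rewrite valid_transfers_rcons vts.
- by rewrite scanl_rcons all_rcons ots foldl_rcons -/X oY.
- lia.
- by rewrite size_rcons; lia.
Qed.

Lemma nth_flatten3 (T : eqType) (f : T -> seq nat) x0 s i r :
  (forall x, size (f x) = 3) -> i < size s -> r < 3 ->
  nth 0 (flatten (map f s)) (3 * i + r) = nth 0 (f (nth x0 s i)) r.
Proof.
move=> f3; elim: s i => //= x s IH [|i] lt_i r3; rewrite nth_cat f3.
  by rewrite muln0 add0n r3.
by rewrite ifF; [rewrite -IH //; congr nth; lia | lia].
Qed.

Lemma stored_input (X : {ffun G -> 'I_n}) : stored ends X (nth 0 (encode_input ends X)).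
Proof.
move=> g; set f := fun h : G => val (X h) :: [seq val i | i <- enum (ends h)].
have f3 h : size (f h) = 3 by rewrite /= size_map -cardE ends2.
have inpE r : r < 3 -> nth 0 (encode_input ends X) (2 + 3 * rank g + r) = nth 0 (f g) r.
  move=> r3; rewrite -[in RHS](nth_enum_rank g g) -nth_flatten3 //.
  by rewrite -cardE; apply: ltn_ord.
have -> : 4 + 3 * rank g = 2 + 3 * rank g + 2 by lia.
have -> : 3 + 3 * rank g = 2 + 3 * rank g + 1 by lia.
rewrite -{1}[2 + 3 * rank g]addn0 !inpE //; split=> // c.
have := ends2 g; rewrite /f -(mem_enum (ends g)) cardE.
case: (enum _) => [|x [|y []]] //= _.
by rewrite !inE -!val_eqE /= !(eq_sym (val c)).
Qed.

Lemma l_initP (X : {ffun G -> 'I_n}) : orientation v X ->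
  reached X 0 (sem l_init (init_state (encode_input ends X))).
Proof.
move=> oX; exists [::]; rewrite /= oX subn0 add0n; split=> //; split.
- by split=> //=; rewrite addn2.
- exact: stored_input.
- split=> //=; rewrite /base. all: move: #|_| => m; lia.
Qed.

(** The two regions may overlap, but the source stays ahead of the destination, so every word is
    read before it is overwritten. *)
Definition copied (M : nat -> nat) k s : Prop :=
  [/\ reg s rL = #|G|.+2, reg s rOne = 1, reg s rDst = k, reg s rSrc = base G + k
    & forall a, mem s a = if a < k then M (base G + a) else M a].

Lemma copied_stable M : stable (copied M).
Proof. by move=> k s s' rs ms [? ? ? ? H]; split; rewrite ?rs // => a; rewrite ms H. Qed.

Lemma l_copyP X0 s : reached X0 (#|G|.+2 ^ 3) s -> exists ts,
  leads_to_ef1_orientation v X0 ts /\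
  forall a, a < size (encode_output ts) ->
    mem (sem l_copy s) a = nth 0 (encode_output ts) a.
Proof.
case=> ts [[vts ots oX potX szX] [[_ _ lE oneE _] _ [bE lenE oE outE]]].
have pot_lt := potential_lt ends X0.
exists ts; split.
  (* After as many steps as the initial potential the potential is 0, whereas an envious agent would
     make it positive. *)
  split=> //; move: potX; rewrite (eqP (ltnW pot_lt)) leqn0 /potential.
  have := last_enviousP ends (foldl transfer X0 ts).
  by case: last_envious => // c _; rewrite addn_eq0 andbF.
rewrite /l_copy 3!semSeq; set s1 := sem _ (sem _ (sem _ s)).
pose M := mem s1.
have c0 : copied M 0 s1 by split; rewrite //= ?bE ?addn0.
have MP a : a < size (encode_output ts) -> M (base G + a) = nth 0 (encode_output ts) a.
  rewrite [size _]/= -/(code ts) size_code /M /= bE lenE.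
  case: a => [|a] lt_a; first by rewrite addn0 eqxx.
  rewrite ifF; last by apply/eqP; lia.
  by rewrite -[RHS]/(nth 0 (code ts) a) -outE //; congr (mem s); lia.
have body k s' : copied M k s' ->
    copied M (k + 1) (sem (LLoad rTmp rSrc ;; LStore rDst rTmp ;;
      LAdd rSrc rSrc rOne ;; LAdd rDst rDst rOne) s').
  case=> l' one' d' s'' m'; split; rewrite //= ?one' ?d' ?s'' ?addnA // => a.
  case: (eqVneq a k) => [->|ak].
    by rewrite m' addn1 ltnSn ltnNge leq_addl.
  by rewrite m' (_ : (a < k + 1) = (a < k)) //; lia.
have lP k s' : copied M k s' -> reg s' rL = #|G|.+2 by case.
have st := @copied_stable M.
have := for_shift st _ lP (for_shift st _ lP (for_shift st _ lP (for_shift st _ lP body))) c0.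
move=> /(_ 34 35 36 37 isT isT isT isT) [_ _ _ _ mE] a lt_a.
(* The output has 1 + 2 [size ts] words, with [size ts] below the cube of |G| + 2, hence fewer than
   its fourth power. *)
rewrite mE -MP //; case: ifP => // /negbT; rewrite -leqNgt => le_a; exfalso.
move: lt_a le_a pot_lt szX; rewrite [size _]/= -/(code ts) size_code !expnS expn0.
by move: (potential _ _) (potential _ _) (size ts) #|G| => p q t m; nia.
Qed.

Lemma l_mainP (X : {ffun G -> 'I_n}) : orientation v X -> exists ts,
  leads_to_ef1_orientation v X ts /\
  forall a, a < size (encode_output ts) ->
    mem (sem l_main (sem l_init (init_state (encode_input ends X)))) a
    = nth 0 (encode_output ts) a.
Proof.
move=> oX; rewrite /l_main semSeq; apply: l_copyP.
have st := @reached_stable X.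
have lP k s' : reached X k s' -> reg s' rL = #|G|.+2 by case=> ts [_ [[]]].
have := for_shift st _ lP (for_shift st _ lP (for_shift st _ lP (@l_stepP X))) (l_initP oX).
move=> /(_ 34 35 36 isT isT isT); rewrite add0n.
by rewrite !expnS expn0.
Qed.

End Run.

Theorem theorem4 :
  (forall (n : nat) (G : finType) (ends : G -> {set 'I_n})
          (X : {ffun G -> 'I_n}),
      (forall g : G, #|ends g| = 2) ->
      orientation (edge_val ends) X ->
      exists ts : seq (G * 'I_n),
        leads_to_ef1_orientation (edge_val ends) X ts)
  /\
  (exists (p : prog) (c d : nat),
    forall (n : nat) (G : finType) (ends : G -> {set 'I_n})
           (X : {ffun G -> 'I_n}),
      (forall g : G, #|ends g| = 2) ->
      orientation (edge_val ends) X ->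
      exists ts : seq (G * 'I_n),
        leads_to_ef1_orientation (edge_val ends) X ts /\
        outputs_within p (encode_input ends X) (c * (n + #|G| + 1) ^ d)
                       (encode_output ts)).
Proof.
split=> [n G ends X ends2 oX|].
  by have [ts [? _]] := l_mainP ends2 oX; exists ts.
exists (PSeq (compile l_init) (compile l_main)).
(* The 2 is there because the largest loop bound, |G| + 2, is at most twice n + |G| + 1. *)
exists (weight l_init + weight l_main * 2 ^ depth l_main), (depth l_main).
move=> n G ends X ends2 oX; have [ts [leads out]] := l_mainP ends2 oX.
exists ts; split=> //; pose s0 := init_state (encode_input ends X); set N := n + #|G| + 1.
have N_gt0 : 0 < N by rewrite /N addn1.
(* [l_init] is timed apart because it writes the registers that bound the loops of [l_main]. It has
   no loop, so no bound register is needed. *)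
have [t1 le1 r1] : exists2 t, t <= weight l_init * 1 ^ depth l_init
    & run (compile l_init) s0 t (sem l_init s0) by apply: (@run_compile [::]).
have [t2 le2 r2] : exists2 t, t <= weight l_main * (2 * N) ^ depth l_main
    & run (compile l_main) (sem l_init s0) t (sem l_main (sem l_init s0)).
  apply: (@run_compile [:: rN; rM; rL]) => //; first by rewrite muln_gt0.
  have [_ [_ [[nE mE lE _ _] _ _]]] := l_initP ends2 oX.
  by move=> y; rewrite !inE => /or3P [] /eqP ->; rewrite ?nE ?mE ?lE /N; lia.
exists (t1 + t2), (sem l_main (sem l_init s0)); split=> //; first exact: RunSeq r1 r2.
rewrite mulnDl leq_add //.
  by rewrite exp1n muln1 in le1; apply: leq_trans le1 _; rewrite leq_pmulr // expn_gt0 N_gt0.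
by apply: leq_trans le2 _; rewrite expnMn mulnA.
Qed.
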